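(* Let $\sigma$ be a mean on $B(\mathcal{H})^+$ with representing function $f$ and associated measure $\mu$. Then the following statements are equivalent: (1) $\sigma$ is strict at the left, i.e. for all $A>0$ and $B>0$, $A\,\sigma\,B=A\implies A=B$; (2) $\sigma$ is not the left-trivial mean $(A,B)\mapsto A$; (3) for all $A\geq 0$, $I\,\sigma\,A=I\implies A=I$; (4) for all $A>0$, $A\,\sigma\,I=A\implies A=I$; (5) for all $A>0$ and $B\geq 0$, $A\,\sigma\,B=A\implies A=B$; (6) for all $A\geq 0$, $I\leq I\,\sigma\,A\implies I\leq A$; (7) for all $A\geq 0$, $I\,\sigma\,A\leq I\implies A\leq I$; (8) for all $A>0$, $A\leq A\,\sigma\,I\implies A\leq I$; (9) for all $A>0$, $A\,\sigma\,I\leq A\implies I\leq A$; (10) for all $A>0$ and $B\geq 0$, $A\leq A\,\sigma\,B\implies A\leq B$; (11) for all $A>0$ and $B\geq 0$, $A\,\sigma\,B\leq A\implies B\leq A$; (12) $f$ is not the constant function $x\mapsto 1$; (13) for all real $x\geq 0$, $f(x)=1\implies x=1$; (14) for all real $x\geq 0$, $f(x)\geq 1\implies x\geq 1$; (15) for all real $x\geq 0$, $f(x)\leq 1\implies x\leq 1$; (16) $\mu$ is not the Dirac measure at $0$.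
   Context: $\mathcal{H}$ is a Hilbert space, $B(\mathcal{H})$ is the algebra of bounded linear operators on $\mathcal{H}$, $B(\mathcal{H})^+$ is the set of positive (i.e. positive semidefinite) operators, and $I$ is the identity operator. For Hermitian $A,B$, $A\leq B$ means $B-A\in B(\mathcal{H})^+$; $A\geq 0$ means $A\in B(\mathcal{H})^+$; $A>0$ means that $A$ is strictly positive, i.e. positive and invertible. $\mathbb{R}^+=[0,\infty)$. A connection is a binary operation $\sigma$ on $B(\mathcal{H})^+$ such that for all positive operators $A,B,C,D$: (M1) $A\leq C$, $B\leq D$ imply $A\,\sigma\,B\leq C\,\sigma\,D$; (M2) $C(A\,\sigma\,B)C\leq (CAC)\,\sigma\,(CBC)$; (M3) if $A_n,B_n\in B(\mathcal{H})^+$, $A_n\downarrow A$ and $B_n\downarrow B$, then $A_n\,\sigma\,B_n\downarrow A\,\sigma\,B$, where $A_n\downarrow A$ means that $(A_n)$ is a decreasing sequence converging strongly to $A$. A mean is a connection $\sigma$ with $A\,\sigma\,A=A$ for all $A\geq 0$. A continuous function $f:\mathbb{R}^+\to\mathbb{R}^+$ is operator monotone if $A\leq B\implies f(A)\leq f(B)$ for all positive operators $A,B$ on any Hilbert space. Standing facts assumed about $\mathcal{H}$ (Kubo–Ando correspondence; it holds for example when $\mathcal{H}$ is infinite-dimensional): for every connection $\sigma$ on $B(\mathcal{H})^+$ there is a unique operator monotone function $f:\mathbb{R}^+\to\mathbb{R}^+$, called the representing function of $\sigma$, with $f(x)I=I\,\sigma\,(xI)$ for all $x\geq 0$, and $\sigma\mapsto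 f$ is a bijection from connections onto operator monotone functions $\mathbb{R}^+\to\mathbb{R}^+$; and there is a unique finite (positive) Borel measure $\mu$ on $[0,1]$, called the associated measure of $\sigma$, with $f(x)=\int_{[0,1]}(1\,!_t\,x)\,d\mu(t)$ for all $x\geq 0$, where $1\,!_t\,x=[(1-t)+t x^{-1}]^{-1}$ for $x>0$, and $1\,!_t\,0=\lim_{x\downarrow 0}1\,!_t\,x$ (equal to $0$ for $t\in(0,1]$ and to $1$ for $t=0$). Every finite Borel measure on $[0,1]$ arises in this way. *)

(* Defs.v *)
From HB Require Import structures.
From mathcomp Require Import all_boot all_order all_algebra.
From mathcomp Require Import sesquilinear complex.
From mathcomp Require Import all_classical all_reals all_analysis.

Set Implicit Arguments.
Unset Strict Implicit.
Unset Printing Implicit Defensive.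

Import Order.TTheory GRing.Theory Num.Theory.
Import numFieldNormedType.Exports.
Local Open Scope classical_set_scope.
Local Open Scope ring_scope.
Local Open Scope complex_scope.

(* Complex Hilbert spaces.  The inner product is linear in its first argument;
   the norm of a normed module over R[i] takes its values in R[i]. *)
Record hilbertType (R : realType) := HilbertType {
  hilbert_sort :> completeNormedModType R[i];
  hdot : {dot hilbert_sort for Num.conj};
  hdot_norm : forall x : hilbert_sort, `|x| ^+ 2 = hdot x x }.

Arguments hdot {R h}.

Section BoundedOperators.
Context {R : realType} (H : hilbertType R).

Definition bounded_linear : {pred H -> H} :=
  [pred A : H -> H | `[< linear A /\
     exists M : R[i], forall x : H, `|A x| <= M * `|x| >]].

Lemma bounded_linearP (A : H -> H) :
  reflect (linear A /\ exists M : R[i], forall x : H, `|A x| <= M * `|x|)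
          (A \in bounded_linear).
Proof. by apply: (iffP idP) => [/asboolP|?] //; apply/asboolP. Qed.

Record bop := BOp { bop_fun :> H -> H; bop_subproof : bop_fun \in bounded_linear }.

HB.instance Definition _ := [isSub for bop_fun].
HB.instance Definition _ := [Choice of bop by <:].

Lemma bounded_linear_submod : submod_closed bounded_linear.
Proof.
split=> [|a A B /bounded_linearP[linA [M hM]] /bounded_linearP[linB [N hN]]].
  apply/bounded_linearP; split=> [c x y|]; first by rewrite /= scaler0 addr0.
  by exists 0 => x; rewrite normr0 mul0r.
apply/bounded_linearP; split=> [c x y|].
  rewrite !fctE linA linB !scalerDr !scalerA [a * c]mulrC -!addrA.
  by congr (_ + _); rewrite addrCA.
exists (`|a| * M + N) => x; rewrite !fctE mulrDl -mulrA.
by rewrite (le_trans (ler_normD _ _))// lerD// normrZ ler_wpM2l.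
Qed.

HB.instance Definition _ :=
  GRing.isSubmodClosed.Build R[i] (H -> H) bounded_linear bounded_linear_submod.
HB.instance Definition _ := [SubChoice_isSubLmodule of bop by <:].

Lemma bop_ext (A B : bop) : A =1 B -> A = B.
Proof. by move=> AB; apply/val_inj/funext. Qed.

Lemma bop_linear (A : bop) : linear A.
Proof. by case: A => A /= /bounded_linearP[]. Qed.

Lemma bounded_linear_id : (fun x : H => x) \in bounded_linear.
Proof. by apply/bounded_linearP; split=> //; exists 1 => x; rewrite mul1r. Qed.

Lemma bounded_linear_comp (A B : bop) : (fun x => A (B x)) \in bounded_linear.
Proof.
case: A B => [A /= /bounded_linearP[linA [M hM]]].
case=> [B /= /bounded_linearP[linB [N hN]]].
apply/bounded_linearP; split=> [c x y|]; first by rewrite linB linA.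
exists (`|M| * N) => x; rewrite (le_trans (hM _))//.
rewrite (le_trans (real_ler_norm _))//.
  by rewrite ger0_real// (le_trans _ (hM _)).
by rewrite normrM normr_id -mulrA ler_wpM2l.
Qed.

Definition bop_one : bop := BOp bounded_linear_id.
Definition bop_mul (A B : bop) : bop := BOp (bounded_linear_comp A B).

Fact bop_mulA : associative bop_mul.
Proof. by move=> A B C; apply: bop_ext. Qed.
Fact bop_mul1 : left_id bop_one bop_mul.
Proof. by move=> A; apply: bop_ext. Qed.
Fact bop_mulr1 : right_id bop_one bop_mul.
Proof. by move=> A; apply: bop_ext. Qed.
Fact bop_mulDl : left_distributive bop_mul +%R.
Proof. by move=> A B C; apply: bop_ext. Qed.
Fact bop_mulDr : right_distributive bop_mul +%R.
Proof.
move=> A B C; apply: bop_ext => x /=.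
by have := bop_linear A 1 (B x) (C x); rewrite !scale1r.
Qed.

HB.instance Definition _ := GRing.Zmodule_isPzRing.Build bop
  bop_mulA bop_mul1 bop_mulr1 bop_mulDl bop_mulDr.

End BoundedOperators.

Section Operators.
Context {R : realType} {H : hilbertType R}.
Implicit Types (A B C F : bop H) (f : R -> R) (p : {poly R}).

(* In R[i], 0 <= z means that z is real and nonnegative, so that on a complex
   space a positive operator is automatically self-adjoint. *)
Definition posop A : Prop := forall x : H, 0 <= hdot (A x) x.

Definition leop A B : Prop := posop (B - A).

Definition invop A : Prop := exists B, A * B = 1 /\ B * A = 1.

Definition sposop A : Prop := posop A /\ invop A.

Definition decreases_to (A_ : nat -> bop H) A : Prop :=
  (forall m n, (m <= n)%N -> leop (A_ n) (A_ m)) /\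
  (forall x : H, A_ n x @[n --> \oo] --> A x).

Definition scalar_op (x : R) : bop H := x%:C *: (1 : bop H).

(* The real points of the spectrum, that is, the whole spectrum when A is
   self-adjoint. *)
Definition spectrum A : set R := [set x : R | ~ invop (A - scalar_op x)].

Definition poly_op p A : bop H := \sum_(i < size p) (p`_i)%:C *: A ^+ i.

(* F = f(A) in the continuous functional calculus of the self-adjoint A: F is
   the limit in operator norm of p_n(A) for some real polynomials p_n converging
   to f uniformly on the spectrum of A. *)
Definition is_fcalc f A F : Prop :=
  exists p : nat -> {poly R},
    (forall e : R, 0 < e -> \forall n \near \oo,
       forall x, spectrum A x -> `|f x - (p n).[x]| < e) /\
    (forall e : R, 0 < e -> \forall n \near \oo,
       forall v : H, `|F v - poly_op (p n) A v| <= e%:C * `|v|).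

End Operators.

Declare Scope bop_scope.
Delimit Scope bop_scope with bop.
Notation "A <= B" := (leop A B) : bop_scope.
Local Open Scope bop_scope.

(* Only the restriction of f to [0, +oo[ matters. *)
Definition operator_monotone {R : realType} (f : R -> R) : Prop :=
  [/\ {within `[0, +oo[, continuous f},
      (forall x : R, (0 <= x)%R -> (0 <= f x)%R) &
      forall (K : hilbertType R) (A B fA fB : bop K),
        posop A -> posop B -> is_fcalc f A fA -> is_fcalc f B fB ->
        A <= B -> fA <= fB].

Section Connections.
Context {R : realType} {H : hilbertType R}.
Implicit Types (s t : bop H -> bop H -> bop H) (f g : R -> R).

(* A binary operation on B(H)^+ is represented by a function on B(H) mapping
   positive operators to positive operators; its other values are irrelevant. *)
Definition connection s : Prop :=
  [/\ forall A B, posop A -> posop B -> posop (s A B),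
      forall A B C D, posop A -> posop B -> posop C -> posop D ->
        A <= C -> B <= D -> s A B <= s C D,
      forall A B C, posop A -> posop B -> posop C ->
        (C * s A B * C)%R <= s (C * A * C)%R (C * B * C)%R &
      forall (A_ B_ : nat -> bop H) A B,
        (forall n, posop (A_ n)) -> (forall n, posop (B_ n)) ->
        decreases_to A_ A -> decreases_to B_ B ->
        decreases_to (fun n => s (A_ n) (B_ n)) (s A B)].

Definition mean s : Prop := connection s /\ forall A, posop A -> s A A = A.

Definition representing_function s f : Prop :=
  operator_monotone f /\
  forall x : R, (0 <= x)%R -> scalar_op (f x) = s 1%R (scalar_op x).

End Connections.

(* The weighted harmonic mean 1 !_t x of 1 and x >= 0, with the value at x = 0
   defined as the limit at 0+. *)
Definition wharm {R : realType} (t x : R) : R :=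
  if x == 0 then (t == 0)%:R else ((1 - t) + t * x^-1)^-1.

(* Finite Borel measures on [0, 1], as measures on R carried by [0, 1]. *)
Definition on01 {R : realType}
    (mu : {finite_measure set (measurableTypeR R) -> \bar R}) : Prop :=
  mu (~` `[0, 1]) = 0%E.

Definition associated_measure {R : realType} (f : R -> R)
    (mu : {finite_measure set (measurableTypeR R) -> \bar R}) : Prop :=
  on01 mu /\
  forall x : R, (0 <= x)%R ->
    (f x)%:E = (\int[mu]_(t in `[0%R, 1%R]) (wharm t x)%:E)%E.

(* Equality of connections is agreement on positive operators, equality of
   representing functions is agreement on [0, +oo[, and equality of measures is
   agreement on Borel sets. *)
Record kubo_ando {R : realType} (H : hilbertType R) : Prop := KuboAndo {
  ka_fun_exists : forall s : bop H -> bop H -> bop H,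
    connection s -> exists f, representing_function s f;
  ka_fun_unique : forall (s : bop H -> bop H -> bop H) (f g : R -> R),
    connection s -> representing_function s f -> representing_function s g ->
    forall x : R, (0 <= x)%R -> f x = g x;
  ka_fun_inj : forall (s t : bop H -> bop H -> bop H) (f g : R -> R),
    connection s -> connection t ->
    representing_function s f -> representing_function t g ->
    (forall x : R, (0 <= x)%R -> f x = g x) ->
    forall A B, posop A -> posop B -> s A B = t A B;
  ka_fun_surj : forall f : R -> R, operator_monotone f ->
    exists s : bop H -> bop H -> bop H,
      connection s /\ representing_function s f;
  ka_measure_exists : forall (s : bop H -> bop H -> bop H) (f : R -> R),
    connection s -> representing_function s f ->
    exists mu, associated_measure f mu;
  ka_measure_unique : forall (s : bop H -> bop H -> bop H) (f : R -> R) mu nu,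
    connection s -> representing_function s f ->
    associated_measure f mu -> associated_measure f nu ->
    forall E : set (measurableTypeR R), measurable E -> mu E = nu E;
  ka_measure_surj : forall mu : {finite_measure set (measurableTypeR R) -> \bar R},
    on01 mu ->
    exists (s : bop H -> bop H -> bop H) (f : R -> R),
      [/\ connection s, representing_function s f & associated_measure f mu] }.

(* Main.v *)
Require Import Defs.
From mathcomp Require Import all_boot all_order all_algebra.
From mathcomp Require Import sesquilinear complex.
From mathcomp Require Import all_classical all_reals all_analysis.
From mathcomp Require Import measurable_realfun ring lra.

(** The proof runs through the single condition that [f] is not the constant 1:
    it implies each of the other statements, and each of them implies it.

    On the scalar side, [f x] is the integral of [wharm t x] and [f 1 = 1].  For
    fixed [x <> 1] the function [wharm t x] of [t] in [0, 1] stays on one side of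
    1 and equals 1 only at [t = 0].  Hence [f x = 1] for one [x <> 1] forces the
    measure to live at 0, and then [f] is constant ([associated_measure_eq1]).
    Together with the monotonicity of [f], this compares [f x] with 1 according to
    the position of [x].

    On the operator side, the scalar comparisons are transferred to operators by
    the transformer inequality [C (A s B) C <= (C A C) s (C B C)], tested only on
    multiples of rank-one operators [Q_u : x |-> <x, u> u], whose
    compressions are explicit.

    - Compressing by [Q_v] gives the Jensen-type upper bound
      [<(A s B) v, v> <= m f (n / m)] with [m = <A v, v>] and [n = <B v, v>]
      ([connection_quad_le]).  So [A <= A s B] yields [f (n / m) >= 1], whence
      [m <= n] for every [v], that is, [A <= B].

    - Compressing [1 s (a / b)] by [Q_u] shows that [Q_u / a <= A] and
      [Q_u / b <= B] imply [(f (a / b) / a) Q_u <= A s B]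
      ([connection_rank_one_ge]).  By the Cauchy-Schwarz inequality these
      hypotheses hold for [u = B x = A w], [a = <A w, w>] and [b = <B x, x>].  If
      [A s B <= A], testing on [w] gives [f (a / b) <= 1], so [a <= b]; one more
      Cauchy-Schwarz inequality, [b^2 = |<A w, x>|^2 <= a <A x, x>], gives
      [<B x, x> <= <A x, x>].

    The equality statements follow by antisymmetry, and those about [A s I] and
    [I s A] are special cases.

    Conversely, if [f] is constantly 1 then [s] has the same representing function
    as [(A, B) |-> A], so they agree, and the scalar operators 0, 1/2, 1 and 2
    refute the operator statements.  This needs [H] to be nonzero, which follows
    from the uniqueness of representing functions ([kubo_ando_nontrivial]). *)

Set Implicit Arguments.
Unset Strict Implicit.
Unset Printing Implicit Defensive.

Import Order.TTheory GRing.Theory Num.Theory.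
Import numFieldNormedType.Exports.

Local Open Scope ring_scope.

(** * Positive operators and their quadratic forms *)

Lemma conjC_of_real (K : numClosedFieldType) (p q : K) :
  p + q \is Num.real -> 'i * (q - p) \is Num.real -> q = p^*.
Proof.
move=> /CrealP; rewrite rmorphD /= => e1 /CrealP.
rewrite rmorphM rmorphB /= conjCi => e2.
have {}e2 : p^* - q^* = q - p.
  by apply: (mulfI (neq0Ci K)); rewrite -e2; ring.
have : p^* *+ 2 = q *+ 2.
  have -> : p^* *+ 2 = (p^* + q^*) + (p^* - q^*) by ring.
  by rewrite e1 e2; ring.
by move=> /eqP; rewrite eqrMn2r => /eqP.
Qed.

Section HilbertForms.
Context {R : realType} {H : hilbertType R}.
Implicit Types (x y u v : H) (c : R[i]) (A B C : bop H).

Lemma hdotDl x y u : hdot (x + y) u = hdot x u + hdot y u.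
Proof. exact: linearDl. Qed.
Lemma hdotZl c x u : hdot (c *: x) u = c * hdot x u.
Proof. exact: linearZl. Qed.
Lemma hdotC x y : hdot x y = (hdot y x)^*%R.
Proof. by rewrite (hermC hdot) expr0 mul1r. Qed.
Lemma norm_hdotC x y : `|hdot x y| = `|hdot y x|.
Proof. by rewrite hdotC; exact: norm_conjC. Qed.
Lemma hdotDr u x y : hdot u (x + y) = hdot u x + hdot u y.
Proof. by rewrite hdotC hdotDl rmorphD /= -!hdotC. Qed.
Lemma hdotZr c u x : hdot u (c *: x) = c^*%R * hdot u x.
Proof. by rewrite hdotC hdotZl rmorphM /= -hdotC. Qed.
Lemma hdot_ge0 x : 0 <= hdot x x.
Proof. by rewrite -hdot_norm exprn_ge0. Qed.
Lemma hdot0_eq0 x : hdot x x = 0 -> x = 0.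
Proof. by rewrite -hdot_norm => /eqP; rewrite expf_eq0 /= normr_eq0 => /eqP. Qed.

Lemma hdot0l x : hdot 0 x = 0.
Proof. exact: linear0l. Qed.
Lemma hdot_gt0 x : x != 0 -> 0 < hdot x x.
Proof.
move=> x0; rewrite lt_def hdot_ge0 andbT; apply: contra x0 => /eqP /hdot0_eq0 ->.
by rewrite eqxx.
Qed.
Lemma hdot_real_gt0 x : x != 0 -> exists2 r : R, 0 < r & hdot x x = (r%:C)%C.
Proof.
move=> x0; have xE : hdot x x = ((complex.Re (hdot x x))%:C)%C.
  by rewrite RRe_real// ger0_real// hdot_ge0.
by exists (complex.Re (hdot x x)); rewrite // -ltcR -xE hdot_gt0.
Qed.

Lemma bopDE A B x : (A + B) x = A x + B x. Proof. by []. Qed.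
Lemma bopNE A x : (- A) x = - A x. Proof. by []. Qed.
Lemma bopZE c A x : (c *: A) x = c *: A x. Proof. by []. Qed.
Lemma bopME A B x : (A * B) x = A (B x). Proof. by []. Qed.
Lemma hdot_bopZ c A x y : hdot ((c *: A) x) y = c * hdot (A x) y.
Proof. exact: hdotZl. Qed.
Lemma bop1E x : (1 : bop H) x = x. Proof. by []. Qed.
Lemma bopxD A x y : A (x + y) = A x + A y.
Proof. by have := bop_linear A 1 x y; rewrite !scale1r. Qed.
Lemma bopx0 A : A 0 = 0.
Proof. by apply: (addrI (A 0)); rewrite -bopxD !addr0. Qed.
Lemma bopxZ A c x : A (c *: x) = c *: A x.
Proof. by have := bop_linear A c x 0; rewrite bopx0 !addr0. Qed.

(** Polarization: the values of the form at [x + y] and [y + i x] being real forces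
    the off-diagonal terms to be conjugate. *)
Lemma posop_hermitian A x y : posop A -> hdot (A x) y = (hdot (A y) x)^*%R.
Proof.
move=> A0.
have rA z : hdot (A z) z \is Num.real by exact/ger0_real/A0.
apply: conjC_of_real.
  have := rA (x + y); rewrite bopxD !(hdotDl, hdotDr).
  have -> : hdot (A x) x + hdot (A x) y + (hdot (A y) x + hdot (A y) y) =
    hdot (A y) x + hdot (A x) y + (hdot (A x) x + hdot (A y) y) by ring.
  by rewrite (rpredDr _ (rpredD (rA x) (rA y))).
have := rA (y + 'i *: x); rewrite bopxD bopxZ !(hdotDl, hdotDr, hdotZl, hdotZr) conjCi.
set a := hdot (A y) y; set b := hdot (A x) x.
set p := hdot (A y) x; set q := hdot (A x) y.
have -> : a + - 'i * p + ('i * q + 'i * (- 'i * b)) = 'i * (q - p) + (a + b).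
  have := sqrCi (R[i]); rewrite expr2 => ii.
  by rewrite [in RHS]mulrBr mulrA mulrN ii; ring.
by rewrite (rpredDr _ (rpredD (rA y) (rA x))).
Qed.

Lemma posop_CauchySchwarz A x y : posop A ->
  `|hdot (A x) y| ^+ 2 <= hdot (A x) x * hdot (A y) y.
Proof.
move=> A0; set a := hdot (A x) x; set b := hdot (A y) y; set p := hdot (A x) y.
have a0 : 0 <= a by exact: A0.
have b0 : 0 <= b by exact: A0.
(* The form at x - t p y, whose phase makes the cross terms real. *)
have key t : 0 <= t -> 0 <= a - 2 * t * `|p| ^+ 2 + t ^+ 2 * `|p| ^+ 2 * b.
  move=> t0; have tE : t^*%R = t by exact/CrealP/ger0_real.
  have := A0 (x + (- (t * p)) *: y).
  rewrite bopxD bopxZ !(hdotDl, hdotDr, hdotZl, hdotZr) -/a -/b -/p.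
  rewrite (posop_hermitian y x A0) -/p rmorphN rmorphM /= tE normCK.
  by congr (0 <= _); ring.
have [b_eq0|bN0] := eqVneq b 0.
  rewrite b_eq0 mulr0; have [->|pN0] := eqVneq p 0; first by rewrite normr0 expr0n.
  have P0 : 0 < `|p| ^+ 2 by rewrite exprn_gt0// normr_gt0.
  (* When b vanishes the bound is affine in t: a large t makes it negative. *)
  have := key ((a + 1) / `|p| ^+ 2); rewrite b_eq0 mulr0 addr0.
  have E P : P != 0 -> a - 2 * ((a + 1) / P) * P = - (a + 2) by move=> ?; field.
  rewrite E ?(gt_eqF P0)//.
  rewrite oppr_ge0 => /(_ (divr_ge0 (addr_ge0 a0 ler01) (ltW P0))).
  by rewrite lt_geF// ltr_wpDl.
have {bN0}b1 : 0 < b by rewrite lt_def bN0.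
have := key b^-1; rewrite invr_ge0 => /(_ b0).
have -> P : a - 2 / b * P + b^-1 ^+ 2 * P * b = a - P / b.
  by field; rewrite gt_eqF.
by rewrite subr_ge0 ler_pdivrMr.
Qed.

Lemma posop1 : posop (1 : bop H). Proof. exact: hdot_ge0. Qed.

Lemma hdot_CauchySchwarz x y : `|hdot x y| ^+ 2 <= hdot x x * hdot y y.
Proof. exact: (posop_CauchySchwarz x y posop1). Qed.

Lemma leopP A B : (A <= B)%bop <-> forall x, hdot (A x) x <= hdot (B x) x.
Proof.
split=> AB x; have := AB x;
  by rewrite bopDE bopNE -scaleN1r hdotDl hdotZl mulN1r subr_ge0.
Qed.

Lemma leop_refl A : (A <= A)%bop. Proof. exact/leopP. Qed.

Lemma leop_trans B A C : (A <= B)%bop -> (B <= C)%bop -> (A <= C)%bop.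
Proof. by move=> /leopP AB /leopP BC; apply/leopP => x; exact: le_trans (BC x). Qed.

Lemma posopZ c A : 0 <= c -> posop A -> posop (c *: A).
Proof. by move=> c0 A0 x; rewrite bopZE hdotZl mulr_ge0. Qed.

Lemma posop_conj A C :
  posop A -> posop C -> posop (C * A * C).
Proof.
move=> A0 C0 x; rewrite !bopME posop_hermitian// hdotC.
by rewrite conjCK; apply: A0.
Qed.

Lemma posop_quad0 A x : posop A -> hdot (A x) x = 0 -> A x = 0.
Proof.
move=> A0 q0; apply: hdot0_eq0; have := posop_CauchySchwarz x (A x) A0.
rewrite q0 mul0r => h; apply/eqP; rewrite -normr_eq0 -sqrf_eq0.
by rewrite eq_le h exprn_ge0.
Qed.

Lemma leop_anti A B : (A <= B)%bop -> (B <= A)%bop -> A = B.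
Proof.
move=> AB BA; apply: bop_ext => x; apply/eqP; rewrite -subr_eq0; apply/eqP.
have q0 : hdot ((A - B) x) x = 0.
  apply/eqP; rewrite eq_le BA andbT -oppr_ge0 -mulN1r -hdotZl.
  by have := AB x; rewrite !bopDE !bopNE scaleN1r opprB.
exact: (posop_quad0 (BA : posop (A - B)) q0).
Qed.

Lemma sposop_quad_gt0 A x : sposop A -> x != 0 -> 0 < hdot (A x) x.
Proof.
move=> [A0 [B [AB BA]]]; apply: contraNT => q0.
have {}q0 : hdot (A x) x = 0.
  by have := A0 x; rewrite le_eqVlt (negPf q0) orbF => /eqP.
by rewrite -[x]bop1E -BA bopME (posop_quad0 A0 q0) bopx0.
Qed.

Lemma bounded_rank_one u : (fun x => hdot x u *: u) \in @bounded_linear R H.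
Proof.
apply/bounded_linearP; split=> [c x y|].
  by rewrite hdotDl hdotZl scalerDl scalerA.
exists (`|u| * `|u|) => x; rewrite normrZ mulrC -mulrA ler_wpM2l// mulrC.
rewrite -(@ler_pXn2r _ 2) ?nnegrE ?mulr_ge0//.
by rewrite exprMn !hdot_norm hdot_CauchySchwarz.
Qed.

(** The square of the norm of [u] times the projection onto the line of [u]; without
    normalisation [u = 0] is allowed. *)
Definition rank_one u : bop H := BOp (bounded_rank_one u).

Lemma rank_oneE u x : rank_one u x = hdot x u *: u. Proof. by []. Qed.

Lemma hdot_rank_one u x : hdot (rank_one u x) x = `|hdot x u| ^+ 2.
Proof. by rewrite rank_oneE hdotZl (hdotC u x) normCK. Qed.

Lemma posop_rank_one u : posop (rank_one u).
Proof. by move=> x; rewrite hdot_rank_one exprn_ge0. Qed.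

(** A rank-one operator sees [A] only through the number [<A u, u>]; this is what
    makes the transformer inequality explicit. *)
Lemma rank_one_compress c u A :
  c *: rank_one u * A * (c *: rank_one u) = (c ^+ 2 * hdot (A u) u) *: rank_one u.
Proof.
apply: bop_ext => x; rewrite !bopME !bopZE !rank_oneE !bopxZ !hdotZl !scalerA.
by congr (_ *: _); ring.
Qed.

(** This is the Cauchy-Schwarz inequality for the form of [A], and it is sharp: the
    two forms agree at [w]. *)
Lemma rank_one_le A w : posop A -> 0 < hdot (A w) w ->
  ((hdot (A w) w)^-1 *: rank_one (A w) <= A)%bop.
Proof.
move=> A0 a0; apply/leopP => x; rewrite bopZE hdotZl hdot_rank_one.
by rewrite norm_hdotC mulrC ler_pdivrMr// mulrC posop_CauchySchwarz.
Qed.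

Lemma scalar_opE (r : R) x : scalar_op r x = (r%:C)%C *: x.
Proof. by []. Qed.

Lemma posop_scalar (r : R) : 0 <= r -> posop (scalar_op r : bop H).
Proof. by move=> r0; apply: posopZ posop1; rewrite lecR. Qed.

Lemma scalar_op1 : scalar_op 1 = 1 :> bop H.
Proof. exact: scale1r. Qed.

Lemma sposop_scalar (r : R) : 0 < r -> sposop (scalar_op r : bop H).
Proof.
move=> r0; split; first exact/posop_scalar/ltW.
exists (scalar_op r^-1); split; apply: bop_ext => x;
  by rewrite bopME !scalar_opE scalerA -rmorphM /= ?(mulfV, mulVf) ?gt_eqF// scale1r.
Qed.

Lemma posop_quadE A x : posop A -> hdot (A x) x = ((complex.Re (hdot (A x) x))%:C)%C.
Proof. by move=> A0; rewrite RRe_real// ger0_real// A0. Qed.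

End HilbertForms.

(** * Rank-one bounds for connections *)

Section ConnectionBounds.
Context {R : realType} {H : hilbertType R}.
Variables (s : bop H -> bop H -> bop H) (f : R -> R).
Hypotheses (hs : connection s) (hf : representing_function s f).
Implicit Types (A B : bop H) (u v x : H).

(** A Jensen-type inequality: compressing both arguments to the line of [v] reduces
    them to scalars, which [1 s (n / m)] dominates. *)
Lemma connection_quad_le A B v (m n : R) : posop A -> posop B -> 0 < m ->
    hdot (A v) v = (m%:C)%C -> hdot (B v) v = (n%:C)%C ->
  hdot (s A B v) v <= ((m * f (n / m))%:C)%C.
Proof.
case: hs => s0 sM sC _ A0 B0 m0 Am Bn.
have n0 : 0 <= n by have := B0 v; rewrite Bn lecR.
have v0 : v != 0.
  by apply: contraTneq m0 => v0; move: Am; rewrite v0 bopx0 hdot0l => -[<-]; rewrite ltxx.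
have [N N0 vN] := hdot_real_gt0 v0.
(* This scaling makes C * A * C the orthogonal projection onto the line of v. *)
pose c := Num.sqrt (m * N)^-1.
have c2 : c ^+ 2 = (m * N)^-1 by rewrite sqr_sqrtr// invr_ge0 mulr_ge0// ltW.
pose C := (c%:C)%C *: rank_one v.
have C0 : posop C by apply: posopZ (posop_rank_one v); rewrite lecR sqrtr_ge0.
have compress (k : R) (D : bop H) : 0 <= k -> hdot (D v) v = (k%:C)%C ->
    (C * D * C <= scalar_op (k / m))%bop.
  move=> k0 Dk; apply/leopP => x.
  rewrite rank_one_compress Dk !hdot_bopZ hdot_rank_one bop1E -rmorphXn /= c2 -rmorphM /=.
  have -> : k / m = (m * N)^-1 * k * N by field; rewrite !gt_eqF.
  rewrite [X in _ <= X * _]rmorphM -mulrA /= -vN mulrC [X in _ <= _ * X]mulrC.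
  rewrite [X in X <= _]mulrC; apply: ler_wpM2l (hdot_CauchySchwarz x v).
  by rewrite lecR mulr_ge0// invr_ge0 mulr_ge0// ltW.
have step : (C * s A B * C <= scalar_op (f (n / m)))%bop.
  apply: (leop_trans (sC _ _ _ A0 B0 C0)).
  rewrite (hf.2 _ (divr_ge0 n0 (ltW m0))); apply: sM.
  - exact: posop_conj.
  - exact: posop_conj.
  - exact: posop1.
  - by apply: posop_scalar; rewrite divr_ge0// ltW.
  - rewrite -scalar_op1 -(divff (negbT (gt_eqF m0))).
    by apply: compress => //; exact: ltW.
  - exact: compress.
have := (leopP _ _).1 step v.
rewrite rank_one_compress !hdot_bopZ hdot_rank_one bop1E (ger0_norm (hdot_ge0 v)).
rewrite (posop_quadE v (s0 _ _ A0 B0)) vN; set q := complex.Re _.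
rewrite -!rmorphXn /= c2 -!rmorphM /= !lecR => h.
have -> : q = m * ((m * N)^-1 * q * N ^+ 2 / N) by field; rewrite !gt_eqF.
by rewrite ler_pM2l// ler_pdivrMr.
Qed.

(** The counterpart of [connection_quad_le] from below: here the transformer
    inequality is applied to the scalar pair [1] and [a / b], whose compressions
    are the given rank-one minorants of [A] and [B]. *)
Lemma connection_rank_one_ge A B u (a b : R) : posop A -> posop B ->
    0 < a -> 0 < b ->
    (((a^-1)%:C)%C *: rank_one u <= A)%bop -> (((b^-1)%:C)%C *: rank_one u <= B)%bop ->
  (((f (a / b) / a)%:C)%C *: rank_one u <= s A B)%bop.
Proof.
case: hs => s0 sM sC _ A0 B0 a0 b0 uA uB.
have [->|u0] := eqVneq u 0.
  move=> x; apply/(leopP _ _).2 : x => x.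
  by rewrite hdot_bopZ hdot_rank_one hdotC hdot0l rmorph0 normr0 expr0n mulr0; apply: s0.
have [N N0 uN] := hdot_real_gt0 u0.
(* This scaling makes C * C equal to a^-1 times the rank-one operator of u. *)
pose c := Num.sqrt (a * N)^-1.
have c2 : c ^+ 2 = (a * N)^-1 by rewrite sqr_sqrtr// invr_ge0 mulr_ge0// ltW.
pose C := (c%:C)%C *: rank_one u.
have C0 : posop C by apply: posopZ (posop_rank_one u); rewrite lecR sqrtr_ge0.
have Cscal (k : R) : C * scalar_op k * C = ((k / a)%:C)%C *: rank_one u.
  rewrite rank_one_compress hdot_bopZ bop1E uN -rmorphXn /= c2 -!rmorphM /=.
  by congr ((_%:C)%C *: _); field; rewrite !gt_eqF.
have ab0 : 0 <= a / b by rewrite divr_ge0 ?ltW.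
rewrite -Cscal (hf.2 _ ab0).
apply: (leop_trans (sC _ _ _ posop1 (posop_scalar ab0) C0)).
apply: sM => //.
- exact: posop_conj posop1 C0.
- exact: posop_conj (posop_scalar ab0) C0.
- by rewrite -scalar_op1 Cscal div1r.
- by rewrite Cscal; have -> : a / b / a = b^-1 by field; rewrite !gt_eqF.
Qed.

Lemma connection_ge_left A B :
    (forall x : R, 0 <= x -> 1 <= f x -> 1 <= x) ->
  posop A -> posop B -> (A <= s A B)%bop -> (A <= B)%bop.
Proof.
move=> f1 A0 B0 AsAB; apply/leopP => v.
have := posop_quadE v A0; have := posop_quadE v B0.
set n := complex.Re (hdot (B v) v); set m := complex.Re (hdot (A v) v) => Bn Am.
have m0 : 0 <= m by have := A0 v; rewrite Am lecR.
have n0 : 0 <= n by have := B0 v; rewrite Bn lecR.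
rewrite Am Bn lecR.
have [->//|mN0] := eqVneq m 0.
have {mN0}m_gt0 : 0 < m by rewrite lt_def mN0.
have := le_trans ((leopP _ _).1 AsAB v) (connection_quad_le A0 B0 m_gt0 Am Bn).
rewrite Am lecR -{1}[m]mulr1 ler_pM2l// => /f1.
by rewrite divr_ge0// ler_pdivlMr// mul1r; apply.
Qed.

(** The quadratic form of [B] at [x] is that of its minorant [Q_u / b] with
    [u = B x].  Invertibility of [A] provides [w] with [A w = u], hence the largest
    multiple of the same [Q_u] below [A], so that the two minorants can be combined
    by [connection_rank_one_ge]. *)
Lemma connection_le_left A B :
    (forall x : R, 0 <= x -> f x <= 1 -> x <= 1) ->
  sposop A -> posop B -> (s A B <= A)%bop -> (B <= A)%bop.
Proof.
move=> f1 Apos B0 sABA; have [A0 [A' [AA' _]]] := Apos.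
apply/leopP => x; set be := hdot (B x) x.
have [->|beN0] := eqVneq be 0; first exact: A0.
have be0 : 0 < be by rewrite lt_def beN0; apply: B0.
pose w := A' (B x); have Aw : A w = B x by rewrite -[LHS]bopME AA' bop1E.
have wN0 : w != 0.
  by apply: contraNneq beN0 => w0; rewrite /be -Aw w0 bopx0 hdot0l.
have al0 := sposop_quad_gt0 Apos wN0.
have := posop_quadE w A0; have := posop_quadE x B0.
set b := complex.Re _; set a := complex.Re _ => bE aE.
have a0 : 0 < a by rewrite -ltcR -aE.
have b0 : 0 < b by rewrite -ltcR -bE.
have leA := rank_one_le A0 al0; have leB := rank_one_le B0 be0.
move: leA leB; rewrite /be Aw bE -Aw aE -!fmorphV => leA leB.
(* The minorant of A is sharp at w, so w reads off the comparison f (a / b) <= 1. *)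
have := (leopP _ _).1 (leop_trans (connection_rank_one_ge A0 B0 a0 b0 leA leB) sABA) w.
rewrite hdot_bopZ hdot_rank_one norm_hdotC aE.
rewrite ger0_norm ?lecR ?(ltW a0)// -rmorphXn -rmorphM /= lecR.
have -> : f (a / b) / a * a ^+ 2 = a * f (a / b) by field; rewrite gt_eqF.
rewrite -[X in (_ <= X)%R -> _]mulr1 ler_pM2l// => /(f1 _ (divr_ge0 (ltW a0) (ltW b0))).
rewrite ler_pdivrMr// mul1r => ab.
(* As <A w, x> = <B x, x> = b, this gives b ^ 2 <= a <A x, x> <= b <A x, x>. *)
have := posop_CauchySchwarz w x A0.
rewrite Aw -/be (ger0_norm (ltW be0)) -Aw aE (posop_quadE x A0) /be bE.
rewrite -rmorphXn -rmorphM /= !lecR expr2; set d := complex.Re _ => b2_le.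
have d0 : 0 <= d by rewrite -lecR -posop_quadE.
rewrite -(ler_pM2l b0) (le_trans b2_le)//.
exact: ler_wpM2r.
Qed.

End ConnectionBounds.

(** * Weighted harmonic means and the associated measure *)

Section HarmonicIntegrals.
Local Open Scope classical_set_scope.
Context {R : realType}.
Implicit Types (t x y : R) (f : R -> R).
Implicit Types mu : {finite_measure set (measurableTypeR R) -> \bar R}.

Lemma wharm_den_gt0 t x : 0 <= t <= 1 -> 0 < x -> 0 < 1 - t + t * x^-1.
Proof.
move=> /andP[t0 t1] x0; have xV : 0 < x^-1 by rewrite invr_gt0.
have [->|tN0] := eqVneq t 0; first by rewrite subr0 mul0r addr0.
by rewrite ltr_wpDl ?subr_ge0// mulr_gt0// lt_def tN0.
Qed.

Lemma wharm0 x : wharm 0 x = 1 :> R.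
Proof. by rewrite /wharm eqxx subr0 mul0r addr0 invr1; case: ifP. Qed.

Lemma wharm1 t : wharm t 1 = 1 :> R.
Proof. by rewrite /wharm oner_eq0 invr1 mulr1 subrK invr1. Qed.

Lemma wharm_ge0 t x : 0 <= t <= 1 -> 0 <= x -> 0 <= wharm t x.
Proof.
move=> t01; rewrite /wharm; case: (eqVneq x 0) => [_ _|xN0 x_ge0].
  by case: (t == 0).
have {xN0 x_ge0}x0 : 0 < x by rewrite lt_def xN0.
by rewrite invr_ge0 (ltW (wharm_den_gt0 t01 x0)).
Qed.

Lemma wharm_le1 t x : 0 <= t <= 1 -> 0 <= x <= 1 -> wharm t x <= 1.
Proof.
move=> t01 /andP[x0 x1]; rewrite /wharm; case: (eqVneq x 0) => [_|xN0].
  by case: (t == 0) => /=; rewrite ?ler01.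
have {xN0}x0' : 0 < x by rewrite lt_def xN0.
rewrite -[leRHS]invr1 lef_pV2 ?posrE ?wharm_den_gt0//.
have : 1 <= x^-1 by rewrite -invr1 lef_pV2 ?posrE.
move: t01 => /andP[t0 t1] xV; nra.
Qed.

Lemma wharm_ge1 t x : 0 <= t <= 1 -> 1 <= x -> 1 <= wharm t x.
Proof.
move=> t01 x1; have x0 : 0 < x by rewrite (lt_le_trans ltr01).
rewrite /wharm gt_eqF// -[leLHS]invr1 lef_pV2 ?posrE ?wharm_den_gt0//.
have : x^-1 <= 1 by rewrite -[leRHS]invr1 lef_pV2 ?posrE.
move: t01 => /andP[t0 t1] xV; nra.
Qed.

Lemma wharm_eq1 t x : x != 1 -> wharm t x = 1 -> t = 0.
Proof.
move=> x1; rewrite /wharm; case: (eqVneq x 0) => [_|xN0].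
  by case: eqP => //= _ /eqP; rewrite eq_sym oner_eq0.
rewrite -[RHS]invr1 => /invr_inj /eqP.
rewrite -subr_eq0 (_ : _ - _ = t * (x^-1 - 1)); last by ring.
rewrite mulf_eq0 subr_eq0 invr_eq1 (negPf x1) orbF.
by move/eqP.
Qed.

Lemma measurable_wharm x : 0 <= x ->
  measurable_fun (`[0, 1] : set (measurableTypeR R)) (fun t => wharm t x).
Proof.
rewrite le_eqVlt => /orP[/eqP<-|x0].
  have -> : (fun t => wharm t 0) = \1_[set 0] :> (R -> R).
    apply/funext => t; rewrite /wharm eqxx indicE; congr ((nat_of_bool _)%:R).
    by apply/eqP/idP; rewrite inE.
  exact: measurable_indic.
apply: subspace_continuous_measurable_fun => //.
apply: continuous_in_subspaceT => t /[!inE] /= ; rewrite in_itv /= => t01.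
rewrite (_ : (fun t => _) = (fun t => (1 - t + t * x^-1)^-1)).
  apply: cvgV; first by rewrite gt_eqF// wharm_den_gt0.
  by apply: cvgD; [apply: cvgB; [exact: cvg_cst|exact: cvg_id]
                  |apply: cvgMl; exact: cvg_id].
by apply/funext => u; rewrite /wharm gt_eqF.
Qed.

Lemma integrable_wharm f mu x : associated_measure f mu -> 0 <= x ->
  mu.-integrable `[0, 1] (EFin \o (fun t => wharm t x)).
Proof.
move=> [_ fE] x0; apply/integrableP; split.
  by apply/measurable_EFinP; exact: measurable_wharm.
rewrite (eq_integral (fun t : measurableTypeR R => (wharm t x)%:E)).
  by rewrite -fE// ltry.
move=> t /[!inE] /=; rewrite in_itv /= => t01.
by rewrite ger0_norm// wharm_ge0.
Qed.

Lemma ae_eq_of_le_integral mu (D : set (measurableTypeR R)) (g h : R -> R) :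
  measurable D -> mu.-integrable D (EFin \o g) -> mu.-integrable D (EFin \o h) ->
  (forall t, D t -> g t <= h t) ->
  (\int[mu]_(t in D) (g t)%:E = \int[mu]_(t in D) (h t)%:E)%E ->
  {ae mu, forall t, D t -> g t = h t}.
Proof.
move=> mD ig ih gh eq_int.
have : (\int[mu]_(t in D) ((h t)%:E - (g t)%:E) = 0)%E.
  rewrite integralB_EFin// eq_int subee//.
  exact: integrable_fin_num.
rewrite (eq_integral (fun t : measurableTypeR R => `|(h t)%:E - (g t)%:E|%E)); last first.
  by move=> t /[!inE] Dt; rewrite gee0_abs// sube_ge0// lee_fin gh.
move/(ae_eq_integral_abs mu mD _).1 => ae0.
apply: filterS (ae0 _) => [t h0 Dt|].
  by have := h0 Dt; rewrite /= -EFinB => -[] /eqP; rewrite subr_eq0 => /eqP.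
by apply: emeasurable_funB; [have /integrableP[] := ih|have /integrableP[] := ig].
Qed.

(** As functions of [t], [wharm t x] and [wharm t 1 = 1] are ordered and have the
    same integral, so they agree almost everywhere; but they agree only at [t = 0],
    where every [wharm t y] is 1. *)
Lemma associated_measure_eq1 f mu x : associated_measure f mu ->
    f 1 = 1 -> 0 <= x -> x != 1 -> f x = 1 ->
  forall y, 0 <= y -> f y = 1.
Proof.
move=> fmu f1 x0 xN1 fx y y0; have [_ fE] := fmu.
have mD : measurable (`[0, 1] : set (measurableTypeR R)) by exact: measurable_itv.
have eq_int : (\int[mu]_(t in `[0%R, 1%R]) (wharm t x)%:E =
               \int[mu]_(t in `[0%R, 1%R]) (wharm t 1)%:E)%E.
  by rewrite -!fE// fx f1.
have ae_filter := ae_filter_ringOfSetsType mu.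
have ae1 : {ae mu, forall t, `[0, 1] t -> wharm t x = wharm t 1}.
  have ix := integrable_wharm fmu x0; have i1 := integrable_wharm fmu ler01.
  have [x1|x1] := leP x 1.
    apply: ae_eq_of_le_integral => // t /=; rewrite in_itv /= => t01.
    by rewrite wharm1 wharm_le1// x0.
  suff : {ae mu, forall t, `[0, 1] t -> wharm t 1 = wharm t x}.
    by apply: filterS => t h /h.
  apply: ae_eq_of_le_integral => // t /=; rewrite in_itv /= => t01.
  by rewrite wharm1 wharm_ge1// ltW.
apply: EFin_inj; rewrite -f1 !fE//; apply: ae_eq_integral => //.
- by apply/measurable_EFinP; exact: measurable_wharm.
- by apply/measurable_EFinP; exact: measurable_wharm.
apply: filterS ae1 => t h /h.
by rewrite wharm1 => /(wharm_eq1 xN1) ->; rewrite !wharm0.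
Qed.

Lemma dirac_on01 (a : measurableTypeR R) : 0 <= a <= 1 ->
  on01 (\d_a : {finite_measure set (measurableTypeR R) -> \bar R}).
Proof.
by move=> a01; rewrite /on01 /= diracE memNset//= => -[]; rewrite in_itv /= a01.
Qed.

Lemma associated_measure_dirac f mu (a : measurableTypeR R) :
    associated_measure f mu -> 0 <= a <= 1 ->
    (forall E, measurable E -> mu E = \d_a E) ->
  forall x, 0 <= x -> f x = wharm a x.
Proof.
move=> [_ fE] a01 muE x x0; apply: EFin_inj; rewrite fE//.
rewrite (@eq_measure_integral _ _ _ _ \d_a); last by move=> E mE _; exact: muE.
rewrite integral_dirac//; last by apply/measurable_EFinP; exact: measurable_wharm.
by rewrite diracE mem_set ?mul1e//= in_itv.
Qed.

Lemma dirac_associated_measure f :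
  (forall x, 0 <= x -> f x = 1) ->
  associated_measure f (\d_(0 : measurableTypeR R) :
    {finite_measure set (measurableTypeR R) -> \bar R}).
Proof.
move=> f1; split; first by apply: dirac_on01; rewrite lexx ler01.
move=> x x0; rewrite f1//.
rewrite integral_dirac//; last by apply/measurable_EFinP; exact: measurable_wharm.
by rewrite diracE mem_set ?mul1e ?wharm0//= in_itv /= lexx ler01.
Qed.
End HarmonicIntegrals.

(** * Means with a constant representing function *)

Section NontrivialSpace.
Context {R : realType} {H : hilbertType R}.

(** On the zero space any function represents any connection, whereas the Dirac
    measures at 0 and 1 produce functions that differ at 0. *)
Lemma kubo_ando_nontrivial : kubo_ando H -> exists x : H, x != 0.
Proof.
move=> hKA; apply: contrapT => /forallNP H0.
have opE (A B : bop H) : A = B.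
  apply: bop_ext => x.
  by have z y : y = 0 :> H; [have /negP/negPn/eqP := H0 y | rewrite (z (A x)) (z (B x))].
have z01 : 0 <= (0 : R) <= 1 by rewrite lexx ler01.
have o01 : 0 <= (1 : R) <= 1 by rewrite lexx ler01.
have [s0 [f0 [cs0 rf0 mf0]]] := ka_measure_surj hKA (dirac_on01 z01).
have [s1 [f1 [_ rf1 mf1]]] := ka_measure_surj hKA (dirac_on01 o01).
have rf1' : representing_function s0 f1 by split=> [|x _]; [exact: rf1.1|exact: opE].
have := ka_fun_unique hKA cs0 rf0 rf1' (lexx 0).
rewrite (associated_measure_dirac mf0 z01)// (associated_measure_dirac mf1 o01)//.
by rewrite /wharm !eqxx oner_eq0 => /eqP; rewrite oner_eq0.
Qed.

Lemma scalar_op_le (a b : R) : (exists x : H, x != 0) ->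
  ((scalar_op a : bop H) <= scalar_op b)%bop <-> a <= b.
Proof.
case=> x x0; have xx := hdot_gt0 x0.
split=> [/leopP/(_ x)|ab].
  by rewrite !hdot_bopZ bop1E ler_pM2r// lecR.
by apply/leopP => y; rewrite !hdot_bopZ bop1E ler_wpM2r ?lecR// hdot_ge0.
Qed.

Lemma scalar_op_inj : (exists x : H, x != 0) ->
  injective (@scalar_op R H).
Proof.
move=> H0 a b ab; apply/eqP; rewrite eq_le.
by apply/andP; split; apply/(scalar_op_le _ _ H0); rewrite ab; exact: leop_refl.
Qed.

Lemma connection_fst : connection (fun A _ : bop H => A).
Proof.
by split=> // A _ C _ _ _; exact: leop_refl.
Qed.
End NontrivialSpace.

Section MeanOfKuboAndo.
Context {R : realType} {H : hilbertType R}.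
Variables (s : bop H -> bop H -> bop H) (f : R -> R).
Variable mu : {finite_measure set (measurableTypeR R) -> \bar R}.
Hypotheses (hKA : kubo_ando H) (hs : mean s).
Hypotheses (hf : representing_function s f) (hmu : associated_measure f mu).

Let nonconst := ~ (forall x : R, 0 <= x -> f x = 1).
Let H0 := kubo_ando_nontrivial hKA.

Lemma representing_mean1 : f 1 = 1.
Proof.
apply: (scalar_op_inj H0); rewrite hf.2 ?ler01// scalar_op1.
by apply: hs.2; exact: posop1.
Qed.

Lemma representing_mean_le x y : 0 <= x -> x <= y -> f x <= f y.
Proof.
move=> x0 xy; have y0 := le_trans x0 xy; have [_ sM _ _] := hs.1.
apply/(scalar_op_le _ _ H0); rewrite !hf.2//.
apply: sM; [exact: posop1|exact: posop_scalar|exact: posop1|exact: posop_scalar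
           |exact: leop_refl|exact/(scalar_op_le _ _ H0)].
Qed.

Lemma nonconst_eq1 x : nonconst -> 0 <= x -> f x = 1 -> x = 1.
Proof.
move=> nc x0 fx; apply/eqP; apply/negPn/negP => xN1; apply: nc.
exact: associated_measure_eq1 hmu representing_mean1 x0 xN1 fx.
Qed.

Lemma nonconst_ge1 x : nonconst -> 0 <= x -> 1 <= f x -> 1 <= x.
Proof.
move=> nc x0 fx; have /orP[//|x1] := le_total 1 x.
rewrite (nonconst_eq1 nc x0) ?lexx//; apply/eqP; rewrite eq_le fx andbT.
by rewrite -representing_mean1 representing_mean_le.
Qed.

Lemma nonconst_le1 x : nonconst -> 0 <= x -> f x <= 1 -> x <= 1.
Proof.
move=> nc x0 fx; have /orP[//|x1] := le_total x 1.
rewrite (nonconst_eq1 nc x0) ?lexx//; apply/eqP; rewrite eq_le fx /=.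
by rewrite -{1}representing_mean1 representing_mean_le// ler01.
Qed.

(** The binary operation [(A, B) |-> A] is itself a connection represented by the
    constant 1, so injectivity of the correspondence identifies [s] with it. *)
Lemma left_trivial_of_const : (forall x : R, 0 <= x -> f x = 1) ->
  forall A B, posop A -> posop B -> s A B = A.
Proof.
move=> f1; apply: (ka_fun_inj hKA hs.1 connection_fst hf _ (fun _ _ => erefl)).
split=> [|x x0]; first exact: hf.1.
by rewrite f1// scalar_op1.
Qed.

Lemma const_of_left_trivial : (forall A B, posop A -> posop B -> s A B = A) ->
  forall x : R, 0 <= x -> f x = 1.
Proof.
move=> s1 x x0; apply: (scalar_op_inj H0).
by rewrite (hf.2 _ x0) (s1 _ _ posop1 (posop_scalar x0)) scalar_op1.
Qed.

Lemma const_iff_dirac : (forall x : R, 0 <= x -> f x = 1) <->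
  (forall E : set (measurableTypeR R), measurable E ->
     mu E = \d_(0 : measurableTypeR R) E).
Proof.
split=> [f1|muE x x0].
  by have := ka_measure_unique hKA hs.1 hf hmu (dirac_associated_measure f1).
rewrite (associated_measure_dirac hmu _ muE)// ?lexx ?ler01//.
exact: wharm0.
Qed.

End MeanOfKuboAndo.

(** * Equivalence of the characterisations of strictness *)

Local Open Scope bop_scope.

Theorem theorem4p4 (R : realType) (H : hilbertType R) (hKA : kubo_ando H)
    (s : bop H -> bop H -> bop H) (hs : mean s)
    (f : R -> R) (hf : representing_function s f)
    (mu : {finite_measure set (measurableTypeR R) -> \bar R})
    (hmu : associated_measure f mu) :
  [<->
    (* 1 *) forall A B, sposop A -> sposop B -> s A B = A -> A = B;
    (* 2 *) ~ (forall A B, posop A -> posop B -> s A B = A);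
    (* 3 *) forall A, posop A -> s 1%R A = 1%R -> A = 1%R;
    (* 4 *) forall A, sposop A -> s A 1%R = A -> A = 1%R;
    (* 5 *) forall A B, sposop A -> posop B -> s A B = A -> A = B;
    (* 6 *) forall A, posop A -> 1%R <= s 1%R A -> 1%R <= A;
    (* 7 *) forall A, posop A -> s 1%R A <= 1%R -> A <= 1%R;
    (* 8 *) forall A, sposop A -> A <= s A 1%R -> A <= 1%R;
    (* 9 *) forall A, sposop A -> s A 1%R <= A -> 1%R <= A;
    (* 10 *) forall A B, sposop A -> posop B -> A <= s A B -> A <= B;
    (* 11 *) forall A B, sposop A -> posop B -> s A B <= A -> B <= A;
    (* 12 *) ~ (forall x : R, (0 <= x)%R -> f x = 1%R);
    (* 13 *) forall x : R, (0 <= x)%R -> f x = 1%R -> x = 1%R;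
    (* 14 *) forall x : R, (0 <= x)%R -> (1 <= f x)%R -> (1 <= x)%R;
    (* 15 *) forall x : R, (0 <= x)%R -> (f x <= 1)%R -> (x <= 1)%R;
    (* 16 *) ~ (forall E : set (measurableTypeR R), measurable E ->
                  mu E = \d_(0%R : measurableTypeR R) E)].
Proof.
have H0 := kubo_ando_nontrivial hKA.
have [cs _] := hs.
set nonconst := ~ (forall x : R, (0 <= x)%R -> f x = 1%R).
have ge_left (nc : nonconst) A B : posop A -> posop B -> A <= s A B -> A <= B.
  by apply: (connection_ge_left cs hf) => x; exact: (nonconst_ge1 hKA hs hf hmu nc).
have le_left (nc : nonconst) A B : sposop A -> posop B -> s A B <= A -> B <= A.
  by apply: (connection_le_left cs hf) => x; exact: (nonconst_le1 hKA hs hf hmu nc).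
have eq_left (nc : nonconst) A B : sposop A -> posop B -> s A B = A -> A = B.
  move=> A0 B0 sAB; apply: leop_anti.
    by apply: ge_left => //; [exact: A0.1|rewrite sAB; exact: leop_refl].
  by apply: le_left => //; rewrite sAB; exact: leop_refl.
have pos1 : posop (1%R : bop H) := posop1.
have spos1 : sposop (1%R : bop H) by rewrite -scalar_op1; exact: sposop_scalar.
have triv (fc : forall x : R, (0 <= x)%R -> f x = 1%R) A B :
    posop A -> posop B -> s A B = A.
  exact: (left_trivial_of_const hKA hs hf fc).
pose two : bop H := scalar_op 2.
pose half : bop H := scalar_op 2^-1.
have stwo : sposop two by exact: sposop_scalar.
have shalf : sposop half by apply: sposop_scalar; rewrite invr_gt0.
have ptwo : posop two := stwo.1.
have phalf : posop half := shalf.1.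
have pos0 : posop (scalar_op 0 : bop H) by exact: posop_scalar.
have two_nle : ~ (two <= 1%R).
  by rewrite -scalar_op1 => /(scalar_op_le _ _ H0); lra.
have half_nge : ~ (1%R <= half).
  by rewrite -scalar_op1 => /(scalar_op_le _ _ H0); lra.
have zero_nge : ~ (1%R <= (scalar_op 0 : bop H)).
  by rewrite -scalar_op1 => /(scalar_op_le _ _ H0); lra.
have two_neq : two <> 1%R by move=> e; apply: two_nle; rewrite e; exact: leop_refl.
(* Each step passes from one statement to the next through nonconst. *)
tfae.
- move=> h; suff nc : nonconst by move=> /(const_of_left_trivial hKA hf).
  by move=> fc; apply/two_neq/h; rewrite ?triv.
- move=> h; suff nc : nonconst by move=> A A0 e; apply/esym/(eq_left nc).
  by move=> fc; apply: h => A B A0 B0; rewrite triv.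
- move=> h; suff nc : nonconst by move=> A A0; exact: (eq_left nc).
  by move=> fc; apply/two_neq/h; rewrite ?triv.
- move=> h; suff nc : nonconst by exact: (eq_left nc).
  by move=> fc; apply/two_neq/h; rewrite ?triv.
- move=> h; suff nc : nonconst by move=> A A0; exact: (ge_left nc _ _ pos1 A0).
  by move=> fc; apply/two_neq/h; rewrite ?triv.
- move=> h; suff nc : nonconst by move=> A A0; exact: (le_left nc _ _ spos1 A0).
  by move=> fc; apply/zero_nge/h; rewrite ?triv//; exact: leop_refl.
- move=> h; suff nc : nonconst by move=> A A0; exact: (ge_left nc _ _ A0.1 pos1).
  by move=> fc; apply/two_nle/h; rewrite ?triv//; exact: leop_refl.
- move=> h; suff nc : nonconst by move=> A A0; exact: (le_left nc _ _ A0 pos1).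
  by move=> fc; apply/two_nle/h; rewrite ?triv//; exact: leop_refl.
- move=> h; suff nc : nonconst by move=> A B A0 B0; exact: (ge_left nc _ _ A0.1 B0).
  by move=> fc; apply/half_nge/h; rewrite ?triv//; exact: leop_refl.
- move=> h; suff nc : nonconst by exact: (le_left nc).
  by move=> fc; apply/two_nle/h; rewrite ?triv//; exact: leop_refl.
- move=> h fc; apply/two_nle/h; rewrite ?triv//; exact: leop_refl.
- by move=> nc x; exact: (nonconst_eq1 hKA hs hf hmu nc).
- move=> h; suff nc : nonconst by move=> x; exact: (nonconst_ge1 hKA hs hf hmu nc).
  by move=> fc; have /esym/eqP := h 0 (lexx _) (fc _ (lexx _)); rewrite oner_eq0.
- move=> h; suff nc : nonconst by move=> x; exact: (nonconst_le1 hKA hs hf hmu nc).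
  by move=> fc; have := h 0 (lexx _); rewrite fc// lexx => /(_ isT); rewrite ler10.
- move=> h /(const_iff_dirac hKA hs hf hmu) fc.
  by have := h 2 (ler0n R 2); rewrite fc// lexx => /(_ isT); lra.
- move=> h; suff nc : nonconst by move=> A B A0 B0; exact: (eq_left nc _ _ A0 B0.1).
  by move=> /(const_iff_dirac hKA hs hf hmu).
Qed.
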